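(* Let $N,m\geq 1$ be integers, let $\Omega\subset\mathbb{R}^N$ be an open domain, $q\geq 1$ and $u\in L^q(\Omega,\mathbb{R}^m)$. If $$\lim_{s\to+\infty}\Big\{s\,\mathcal{L}^{2N}\Big(\Big\{(x,y)\in\Omega\times\Omega:\frac{|u(y)-u(x)|^q}{|y-x|^{q+N}}>s\Big\}\Big)\Big\}=0,$$ then $u$ is equal to a constant almost everywhere in $\Omega$.
   Context: A domain is a connected open set. $|\cdot|$ denotes the Euclidean norm and $\mathcal{L}^{2N}$ is Lebesgue measure in $\mathbb{R}^{2N}=\mathbb{R}^N\times\mathbb{R}^N$. *)

(* Defs.v *)
From HB Require Import structures.
From mathcomp Require Import all_boot all_order all_algebra.
From mathcomp Require Import all_classical all_reals all_analysis.

Set Implicit Arguments.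
Unset Strict Implicit.
Unset Printing Implicit Defensive.

Import Order.TTheory GRing.Theory Num.Theory.
Import numFieldNormedType.Exports.
Local Open Scope classical_set_scope.
Local Open Scope ring_scope.

(* The library's norm on 'rV[R]_n is the sup norm; it induces the same topology
   (used below for open and connected sets) but is not the Euclidean norm. *)
Definition enorm (R : realType) (n : nat) (x : 'rV[R]_n) : R :=
  Num.sqrt (\sum_i x ord0 i ^+ 2).

Definition rV_display : measure_display. Proof. exact. Qed.

Section measurable_rV.
Context {R : realType} {n : nat}.

Definition rV_coor (i : 'I_n) (x : 'rV[R]_n) : measurableTypeR R := x ord0 i.

Let rV_set0 : g_sigma_preimage rV_coor set0.
Proof. exact: sigma_algebra0. Qed.

Let rV_setC A : g_sigma_preimage rV_coor A -> g_sigma_preimage rV_coor (~` A).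
Proof. exact: sigma_algebraC. Qed.

Let rV_bigcup (F : (set 'rV[R]_n)^nat) :
  (forall i, g_sigma_preimage rV_coor (F i)) ->
  g_sigma_preimage rV_coor (\bigcup_i (F i)).
Proof. exact: sigma_algebra_bigcup. Qed.

(* The product of n copies of the Borel sigma-algebra of R, as for n.-tuple. *)
HB.instance Definition _ := @isMeasurable.Build rV_display
  'rV[R]_n (g_sigma_preimage rV_coor) rV_set0 rV_setC rV_bigcup.

End measurable_rV.

Lemma measurable_rV_coor (R : realType) (n : nat) (i : 'I_n) :
  measurable_fun [set: 'rV[R]_n] (rV_coor i).
Proof.
move=> _ Y mY; rewrite setTI; apply: sub_sigma_algebra.
rewrite -bigcup_seq/=; exists i => /=; first by rewrite mem_index_enum.
by exists Y => //; rewrite setTI.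
Qed.

Lemma measurable_fun_rVP d (T : measurableType d) (R : realType) (n : nat)
    (f : T -> 'rV[R]_n) :
  measurable_fun [set: T] f <->
  forall i, measurable_fun [set: T] (rV_coor i \o f).
Proof.
split=> [mf i|mf]; first exact: measurableT_comp (measurable_rV_coor i) mf.
apply: measurability; first by [].
move=> _ [A + <-]; rewrite -bigcup_seq => -[i _ [B mB <-]].
by rewrite !setTI; have := mf i measurableT B mB; rewrite setTI.
Qed.

Definition rV_cons (R : realType) (n : nat)
    (p : measurableTypeR R * 'rV[R]_n) : 'rV[R]_n.+1 :=
  row_mx (p.1 : R)%:M p.2.

Lemma rV_coor_cons0 (R : realType) (n : nat) (p : measurableTypeR R * 'rV[R]_n) :
  rV_coor ord0 (rV_cons p) = p.1.
Proof.
rewrite /rV_coor /rV_cons mxE; case: splitP => // j _.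
by rewrite mxE !ord1 eqxx mulr1n.
Qed.

Lemma rV_coor_consS (R : realType) (n : nat) (p : measurableTypeR R * 'rV[R]_n)
    (i : 'I_n) :
  rV_coor (lift ord0 i) (rV_cons p) = rV_coor i p.2.
Proof.
rewrite /rV_coor /rV_cons mxE; case: splitP => /= j ij.
  by move: (ltn_ord j); rewrite -ij.
by congr (p.2 _ _); apply/val_inj; move: ij => /= [].
Qed.

Lemma measurable_rV_cons (R : realType) (n : nat) :
  measurable_fun setT (@rV_cons R n).
Proof.
apply/measurable_fun_rVP => i; have [j ->|->] := unliftP ord0 i.
- rewrite (_ : _ \o _ = rV_coor j \o snd).
    exact: measurableT_comp (measurable_rV_coor j) measurable_snd.
  by apply/funext => p /=; rewrite rV_coor_consS.
- rewrite (_ : _ \o _ = fst); first exact: measurable_fst.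
  by apply/funext => p /=; rewrite rV_coor_cons0.
Qed.

(* Lebesgue measure on the Borel sets of R^n = R * (R * (... * R^0)), as an
   iterated product of the one-dimensional one; see borel_leb_box. *)
Fixpoint borel_leb (R : realType) (n : nat) : set 'rV[R]_n -> \bar R :=
  match n with
  | 0 => \d_(0 : 'rV[R]_0)
  | k.+1 => pushforward (lebesgue_measure \x @borel_leb R k)%E (@rV_cons R k)
  end.
Arguments borel_leb : clear implicits.

Definition rV_uncons (R : realType) (n : nat) (x : 'rV[R]_n.+1) :
    measurableTypeR R * 'rV[R]_n :=
  (x ord0 ord0, \row_i x ord0 (lift ord0 i)).

Lemma rV_consK (R : realType) (n : nat) : cancel (@rV_cons R n) (@rV_uncons R n).
Proof.
move=> p; rewrite /rV_uncons [X in (X, _)](_ : _ = p.1); last exact: rV_coor_cons0.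
rewrite [RHS]surjective_pairing; congr pair.
by apply/rowP => i; rewrite mxE; exact: rV_coor_consS.
Qed.

Lemma measurable_rV_uncons (R : realType) (n : nat) :
  measurable_fun setT (@rV_uncons R n).
Proof.
apply/measurable_fun_pairP; split; first exact: (measurable_rV_coor ord0).
apply/measurable_fun_rVP => i.
rewrite (_ : _ \o _ = rV_coor (lift ord0 i)); first exact: measurable_rV_coor.
by apply/funext => x; rewrite /= /rV_coor mxE.
Qed.

Lemma pack_sigma_finite d (T : measurableType d) (R : realType)
    (mu : {measure set T -> \bar R}) :
    sigma_finite setT mu ->
  exists nu : {sigma_finite_measure set T -> \bar R}, mu = nu :> (set T -> \bar R).
Proof.
case: mu => mu [mu1 mu2] mu_sfin.
pose mixin := Measure_isSigmaFinite.Build _ _ _ (Measure.Pack (Measure.Class mu2)) mu_sfin.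
pose nu := HB.pack_for {sigma_finite_measure set T -> \bar R}
  (mu : set T -> \bar R) mu1 mu2 mixin.
by exists nu.
Qed.

Lemma pushforward_measure d1 d2 (T1 : measurableType d1)
    (T2 : measurableType d2) (R : realType)
    (m : {measure set T1 -> \bar R}) (f : T1 -> T2) :
    measurable_fun setT f ->
  exists nu : {measure set T2 -> \bar R}, pushforward m f = nu.
Proof.
move=> mf; pose f_mixin := isMeasurableFun.Build _ _ _ _ _ mf.
pose f' := MeasurableFun.Pack (MeasurableFun.Class f_mixin).
by unshelve eexists (pushforward m f').
Qed.

Lemma pushforward_sigma_finite d1 d2 (T1 : measurableType d1)
    (T2 : measurableType d2) (R : realType)
    (m : {sigma_finite_measure set T1 -> \bar R}) (f : T1 -> T2) (g : T2 -> T1) :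
    measurable_fun setT f -> measurable_fun setT g -> cancel f g ->
  exists nu : {sigma_finite_measure set T2 -> \bar R}, pushforward m f = nu.
Proof.
move=> mf mg fK; have [mu muE] := pushforward_measure m mf.
rewrite muE; apply: pack_sigma_finite; rewrite -muE.
have [F FT mF] := sigma_finiteT m.
exists (fun k => g @^-1` F k); first by rewrite -preimage_bigcup -FT preimage_setT.
move=> k; have [mFk Fky] := mF k; split.
  by rewrite -[X in measurable X]setTI; exact: mg.
rewrite /pushforward (_ : _ @^-1` _ = F k)//.
by apply/seteqP; split=> p /=; rewrite fK.
Qed.

(* The library's sigma-finite instance on a product measure is shadowed by the
   one for finite measures, so canonical inference does not find it. *)
Lemma product_sigma_finite d1 d2 (T1 : measurableType d1)
    (T2 : measurableType d2) (R : realType)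
    (m1 : {sigma_finite_measure set T1 -> \bar R})
    (m2 : {sigma_finite_measure set T2 -> \bar R}) :
  exists m : {sigma_finite_measure set (T1 * T2)%type -> \bar R}, (m1 \x m2)%E = m.
Proof.
have := @pack_sigma_finite _ _ _ (m1 \x m2)%E; apply.
have /sigma_finiteP[F [TF ndF Foo]] := sigma_finiteT m1.
have /sigma_finiteP[G [TG ndG Goo]] := sigma_finiteT m2.
exists (fun n => F n `*` G n).
  rewrite -setXTT TF TG predeqE => -[x y]; split.
    move=> [/= [n _ Fnx] [k _ Gky]]; exists (maxn n k) => //; split.
    - by move: x Fnx; exact/subsetPset/ndF/leq_maxl.
    - by move: y Gky; exact/subsetPset/ndG/leq_maxr.
  by move=> [n _ []/= ? ?]; split; exists n.
move=> k; have [? ?] := Foo k; have [? ?] := Goo k.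
split; first exact: measurableX.
by rewrite /= product_measure1E// lte_mul_pinfty// ge0_fin_numE.
Qed.

Lemma borel_leb_sigma_finite_measure (R : realType) (n : nat) :
  exists mu : {sigma_finite_measure set 'rV[R]_n -> \bar R},
    borel_leb R n = mu.
Proof.
elim: n => [|n [mu muE]]; first by exists (\d_(0 : 'rV[R]_0)).
have [m mE] := product_sigma_finite (@lebesgue_measure R) mu.
have [nu nuE] := pushforward_sigma_finite m
  (@measurable_rV_cons R n) (@measurable_rV_uncons R n) (@rV_consK R n).
by exists nu; rewrite -nuE -mE /= muE.
Qed.

Lemma borel_leb0 (R : realType) n : borel_leb R n set0 = 0.
Proof. by have [mu ->] := borel_leb_sigma_finite_measure R n; rewrite measure0. Qed.

Lemma borel_leb_ge0 (R : realType) n A : (0 <= borel_leb R n A)%E.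
Proof. by have [mu ->] := borel_leb_sigma_finite_measure R n; rewrite measure_ge0. Qed.

Lemma borel_leb_semi_sigma_additive (R : realType) n :
  semi_sigma_additive (borel_leb R n).
Proof.
have [mu ->] := borel_leb_sigma_finite_measure R n.
exact: measure_semi_sigma_additive.
Qed.

Lemma borel_leb_sigma_finite (R : realType) n : sigma_finite setT (borel_leb R n).
Proof. have [mu ->] := borel_leb_sigma_finite_measure R n; exact: sigma_finiteT. Qed.

HB.instance Definition _ (R : realType) (n : nat) := isMeasure.Build _ _ _
  (borel_leb R n) (borel_leb0 R n) (@borel_leb_ge0 R n)
  (@borel_leb_semi_sigma_additive R n).

HB.instance Definition _ (R : realType) (n : nat) :=
  Measure_isSigmaFinite.Build _ _ _ (borel_leb R n) (borel_leb_sigma_finite R n).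

Lemma borel_leb_box (R : realType) (n : nat) (A : 'I_n -> set (measurableTypeR R)) :
    (forall i, measurable (A i)) ->
  borel_leb R n [set x | forall i, A i (x ord0 i)] =
  (\prod_(i < n) lebesgue_measure (A i))%E.
Proof.
elim: n => [|n IHn] in A * => mA.
  by rewrite big_ord0 /= diracE mem_set// => -[].
rewrite big_ord_recl -IHn// /= /pushforward.
rewrite -product_measure1E//; last first.
  rewrite [X in measurable X](_ : _ = \bigcap_(i : 'I_n) (rV_coor i @^-1` A (lift ord0 i))).
    by apply: fin_bigcap_measurable => // i _; rewrite -[X in measurable X]setTI;
       exact: measurable_rV_coor.
  by apply/seteqP; split=> x /= Ax i; [move=> _|]; exact: Ax.
congr (_ _); apply/seteqP; split=> -[a x] /=.
  move=> Aax; split=> [|i]; first by rewrite -[a](rV_coor_cons0 (a, x)); exact: Aax.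
  by rewrite -[x ord0 i](rV_coor_consS (a, x) i); exact: Aax.
move=> [Aa Ax] i; have [j ->|->] := unliftP ord0 i.
  by have := Ax j; rewrite -[x ord0 j](rV_coor_consS (a, x) j).
by move: Aa; rewrite -[X in A _ X -> _](rV_coor_cons0 (a, x)).
Qed.

(* 'rV[R]_n with the sigma-algebra of Lebesgue measurable sets, i.e. the sets
   that are Caratheodory measurable for the outer measure of borel_leb. *)
Notation lebT R n := (caratheodory_type (mu_ext (borel_leb R n))).

(* n-dimensional Lebesgue measure, complete on lebT R n; as a function it is
   defined on all sets, where it is the Lebesgue outer measure. *)
Definition leb (R : realType) (n : nat) : set (lebT R n) -> \bar R :=
  @completed_measure_extension _ _ R (borel_leb R n).
Arguments leb : clear implicits.
HB.instance Definition _ (R : realType) (n : nat) := Measure.on (leb R n).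

Lemma leb_borel (R : realType) (n : nat) (A : set 'rV[R]_n) :
  measurable A -> leb R n A = borel_leb R n A.
Proof. by move=> mA; exact: measurable_mu_extE. Qed.

Lemma open_measurable_rV (R : realType) (n : nat) (A : set 'rV[R]_n) :
  open A -> measurable A.
Proof.
move=> oA.
pose c (p : 'rV[rat]_n) : 'rV[R]_n := map_mx ratr p.
pose B (z : 'rV[rat]_n * nat) : set 'rV[R]_n := ball (c z.1) z.2.+1%:R^-1.
have mB z : measurable (B z).
  rewrite (_ : B z =
    \bigcap_(i : 'I_n) (rV_coor i @^-1` ball (c z.1 ord0 i) z.2.+1%:R^-1)).
    apply: fin_bigcap_measurable => // i _; rewrite -[X in measurable X]setTI.
    by apply: measurable_rV_coor => //; rewrite ball_itv; exact: measurable_itv.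
  apply/seteqP; split=> x /=.
    by move=> [_ Bx] i _; exact: Bx.
  by move=> Bx; split=> [|i j]; rewrite ?invr_gt0// ord1; exact: Bx.
have -> : A = \bigcup_(z in [set z | B z `<=` A]) B z.
  apply/seteqP; split=> [x Ax|x [z /= BzA]]; last exact: BzA.
  have /nbhs_ballP[e /= e0 xeA] : nbhs x A by exact: open_nbhs_nbhs.
  have [k ke] : exists k : nat, k.+1%:R^-1 < e / 2.
    have [k] := @ltr_add_invr R 0 (e / 2) (divr_gt0 e0 (ltr0Sn R 1)).
    by rewrite add0r; exists k.
  have qP i : exists r : rat, ball (x ord0 i) k.+1%:R^-1 (ratr r : R).
    have : x ord0 i - k.+1%:R^-1 < x ord0 i + k.+1%:R^-1.
      by rewrite ltrD2l (@lt_trans _ _ 0)// ?oppr_lt0 invr_gt0.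
    by move=> /rat_in_itvoo[r rI]; exists r; rewrite ball_itv.
  have /choice[r rP] := qP.
  have xc : ball (c (\row_i r i)) k.+1%:R^-1 x.
    split=> [|i j]; rewrite ?invr_gt0// !mxE ord1; apply: ball_sym; exact: rP.
  exists (\row_i r i, k) => //= y yB; apply: xeA.
  have : ball x (e / 2 + e / 2) y.
    apply: (@ball_triangle _ _ (c (\row_i r i))).
    - exact/ball_sym/(le_ball (ltW ke)).
    - exact: le_ball (ltW ke) _ yB.
  by rewrite -splitr.
rewrite bigcup_mkcond; apply: countable_bigcupT_measurable => // z.
by case: ifP.
Qed.

(* u is total, but only its restriction to Omega is constrained. The integral is
   finite iff the L^q norm of the Euclidean norm of u on Omega is. *)
Definition Lq (R : realType) (N m : nat) (Omega : set 'rV[R]_N) (q : R)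
    (u : 'rV[R]_N -> 'rV[R]_m) : Prop :=
  measurable_fun (Omega : set (lebT R N)) (u : lebT R N -> 'rV[R]_m) /\
  (\int[leb R N]_(x in Omega) (enorm (u x) `^ q)%:E < +oo)%E.

(* Main.v *)
Require Import Defs.
From mathcomp Require Import all_boot all_order all_algebra.
From mathcomp Require Import all_classical all_reals all_analysis.
From mathcomp Require Import measurable_realfun ring lra.

Set Implicit Arguments.
Unset Strict Implicit.
Unset Printing Implicit Defensive.

Import Order.TTheory GRing.Theory Num.Theory.
Import numFieldNormedType.Exports.
Local Open Scope classical_set_scope.
Local Open Scope ring_scope.

(** The reason why the theorem holds is a monotonicity along dyadic scales.
    On a ball Q inside Omega put
      F (x, y) = min (1, |g y - g x|) ^ q / |y - x| ^ (q + N),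
    where g is one coordinate of u, and let I r be the integral of F over the
    pairs of points of Q at distance in [r / 2, r[.  Going from x to y through
    the midpoint m, the triangle inequality and the convexity of t |-> t ^ q
    give F (x, y) <= 2 ^ -(N + 1) * (F (x, m) + F (y, m)) ([trunc_quot_mid]);
    the change of variables y |-> m has Jacobian 2 ^ -N and maps the shell of
    radius r into the shell of radius r / 2.  The powers of 2 cancel exactly:
    I r <= I (r / 2) ([shell_energy_half]).

    Hence K * I r is at most the sum of the K first energies I (r / 2 ^ k), i.e.
    at most the integral of F over the pairs at distance between r / 2 ^ K and
    r.  There F is bounded by a constant times 2 ^ (K * (q + N)), because the
    numerator is truncated at 1.  By the layer cake formula along the thresholds
    S * 2 ^ j, this integral is at most S * |Q| ^ 2 plus one term
    S * 2 ^ j * |{F > S * 2 ^ j}| for each of the O(K) values of j.  Each such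
    term is smaller than any given eta as soon as S is large, which is the
    hypothesis of the theorem.  Dividing by K and letting K tend to infinity,
    I r <= p * eta with p independent of eta ([shell_energy_bound]), so that
    I r = 0 for every r > 0 ([shell_energy_eq0]).  So g x = g y for almost all
    (x, y) in Q * Q, and g is almost everywhere constant on Q by Fubini
    ([ae_constant_of_negligible_neq]).

    Connectedness of Omega makes the constants of the balls agree
    ([ae_constant_of_locally]).  Since u is measurable only for the completed
    sigma-algebra, each of its coordinates is first replaced by a Borel function
    which equals it outside a Borel null set ([borel_representative]). *)

(** * Borel representatives of functions measurable for the completion *)

Section borel_representative.
Context d (T : measurableType d) (R : realType).
Variable mu : {sigma_finite_measure set T -> \bar R}.
Local Notation cT := (caratheodory_type (mu_ext mu)).

Let mu_extE (A : set T) : measurable A -> mu_ext mu A = mu A.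
Proof. exact: (@measurable_mu_extE _ R T mu). Qed.

(** Measurable hull: intersect coverings of [A] whose measures approach the outer
    measure. *)
Lemma mu_ext_hull (A : set T) :
  exists G : set T, [/\ measurable G, A `<=` G & mu G = mu_ext mu A].
Proof.
have [muAy|muAfin] := eqVneq (mu_ext mu A) +oo%E.
  exists setT; split => //; apply/eqP; rewrite muAy -leye_eq -muAy.
  by rewrite -[leRHS]mu_extE//; exact: le_mu_ext.
have fA : mu_ext mu A \is a fin_num.
  by rewrite ge0_fin_numE ?mu_ext_ge0// ltey.
have GP (n : nat) : exists G : set T, [/\ measurable G, A `<=` G &
    (mu G <= mu_ext mu A + n.+1%:R^-1%:E)%E].
  have [//|_ [F [mF AF] <-] Fle] := lb_ereal_inf_adherent _ fA (e := n.+1%:R^-1).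
  exists (\bigcup_k F k); split => //; first exact: bigcupT_measurable.
  apply: le_trans (ltW Fle); apply: measure_sigma_subadditive => //.
  exact: bigcupT_measurable.
have /choice[G {}GP] := GP.
have mG : measurable (\bigcap_n G n) by apply: bigcapT_measurable => n; have [] := GP n.
have AG : A `<=` \bigcap_n G n by move=> x Ax n _; have [_ + _] := GP n; exact.
exists (\bigcap_n G n); split => //; apply/eqP; rewrite eq_le; apply/andP; split.
  apply/lee_addgt0Pr => e e0.
  have [n ne] : exists n : nat, n.+1%:R^-1 < e.
    by have [n] := @ltr_add_invr R 0 e e0; rewrite add0r; exists n.
  have [mGn _ Gle] := GP n.
  apply: (@le_trans _ _ (mu (G n))).
    by apply: le_measure; rewrite ?inE//; exact: bigcap_inf.
  by apply: le_trans Gle _; rewrite leeD2l// lee_fin ltW.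
by rewrite -mu_extE//; exact: le_mu_ext.
Qed.

(** If [G] is a hull of [E], then [G `\` E] is null for the outer measure, so a
    hull [H] of it is null, and [E] coincides with [G] outside [H]. *)
Lemma caratheodory_borel_diff_null (E : set T) :
    measurable (E : set cT) ->
  exists H : set T, [/\ measurable H, mu H = 0%E & measurable (E `\` H)].
Proof.
(* The finite case extends to E by cutting along a sigma-finite exhaustion. *)
move=> mE; wlog muEfin : E mE / (mu_ext mu E < +oo)%E.
  move=> fin_case.
  have [F TF mF] := sigma_finiteT mu.
  have cF k : measurable (F k : set cT).
    apply: sub_caratheodory; apply: sub_sigma_algebra; exact: (mF k).1.
  have /choice[H HP] : forall k, exists H : set T,
      [/\ measurable H, mu H = 0%E & measurable ((E `&` F k) `\` H)].
    move=> k; apply: fin_case; first exact: measurableI.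
    apply: le_lt_trans (mF k).2.
    rewrite -[leRHS]mu_extE; last exact: (mF k).1.
    by apply: le_mu_ext => x [].
  have mH k : measurable (H k) by have [] := HP k.
  have mUH : measurable (\bigcup_k H k) by exact: bigcupT_measurable.
  exists (\bigcup_k H k); split => //.
    apply/(negligibleP mu mUH); apply: negligible_bigcup => k.
    by apply/negligibleP => //; have [] := HP k.
  rewrite (_ : _ `\` _ = \bigcup_k (((E `&` F k) `\` H k) `\` \bigcup_j H j)).
    apply: bigcupT_measurable => k; apply: measurableD => //.
    by have [] := HP k.
  apply/seteqP; split => [x [Ex nHx]|x [k _ [[[Ex _] _] nHx]]]; last by split.
  have [k _ Fkx] : (\bigcup_k F k) x by rewrite -TF.
  exists k => //; split=> //; split=> // Hkx; apply: nHx; by exists k.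
have [G [mG EG muG]] := mu_ext_hull E.
have [H [mH GEH muH]] := mu_ext_hull (G `\` E).
exists H; split => //.
  rewrite muH.
  have muEfin' : mu_ext mu E \is a fin_num by rewrite ge0_fin_numE ?mu_ext_ge0.
  have := mE G; rewrite /= mu_extE// muG setIidr// setDE.
  case: (mu_ext mu E) muEfin' => [a| |]// _.
  case: (mu_ext mu _) => [b| |]// [ab]; congr EFin; lra.
rewrite (_ : E `\` H = G `\` H); first exact: measurableD.
apply/seteqP; split => x [+ nHx]; first by move=> /EG.
move=> Gx; split => //; apply: contrapT => nEx; exact/nHx/GEH.
Qed.

(** It suffices to correct the countably many superlevel sets of [f] at rational
    thresholds. *)
Lemma borel_representative (D : set T) (f : T -> R) : measurable D ->
    measurable_fun (D : set cT) (f : cT -> R) ->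
  exists (H : set T) (g : T -> R), [/\ measurable H, mu H = 0%E,
    measurable_fun setT g & forall x, D x -> ~ H x -> g x = f x].
Proof.
move=> mD mf.
have cD : measurable (D : set cT).
  by apply: sub_caratheodory; exact: sub_sigma_algebra.
have /choice[H HP] : forall r : rat, exists H : set T, [/\ measurable H, mu H = 0%E &
    measurable ((D `&` f @^-1` `]ratr r, +oo[) `\` H)].
  by move=> r; apply: caratheodory_borel_diff_null; apply: mf => //;
    exact: measurable_itv.
pose h n := if unpickle n is Some r then H r else set0.
have mh n : measurable (h n).
  by rewrite /h; case: unpickle => // r; have [] := HP r.
have mUh : measurable (\bigcup_n h n) by exact: bigcupT_measurable.
pose g := f \_ (D `\` \bigcup_n h n).
exists (\bigcup_n h n), g; split => //.
- apply/(negligibleP mu mUh); apply: negligible_bigcup => n.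
  apply/negligibleP => //; rewrite /h; case: unpickle => [r|]; last exact: measure0.
  by have [] := HP r.
- apply/(measurable_restrictT _ _).1; first exact: measurableD.
  move=> mDh; apply: (measurability _ (RGenOInfty.measurableE R)) => //.
  move=> _ [_ [a ->] <-].
  rewrite (_ : _ `&` _ = \bigcup_(r in [set r : rat | a < ratr r])
      (((D `&` f @^-1` `]ratr r, +oo[) `\` H r) `\` \bigcup_n h n)).
    rewrite bigcup_mkcond; apply: countable_bigcupT_measurable => // r.
    by case: ifP => // _; apply: measurableD => //; have [] := HP r.
  apply/seteqP; split => [x [[Dx nhx]]|x [r /= ar [[[Dx]]]]] /=; rewrite !in_itv/= !andbT.
    move=> /rat_in_itvoo[r]; rewrite in_itv/= => /andP[ar rf].
    exists r => //; split=> //; split; first by split => //=; rewrite in_itv/= andbT.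
    move=> Hrx; apply: nhx; exists (pickle r); first exact: I.
    by rewrite /h pickleK.
  by move=> rf nHx nhx; split => //; exact: lt_trans ar rf.
- by move=> x Dx nhx; rewrite /g patchE mem_set.
Qed.

End borel_representative.

(** * Real inequalities *)

Lemma powR_midpoint_le (R : realType) (q a b : R) : 1 <= q -> 0 <= a -> 0 <= b ->
  (2^-1 * (a + b)) `^ q <= 2^-1 * (a `^ q + b `^ q).
Proof.
move=> q1 a0 b0; have h0 : 0 <= 2^-1 :> R by lra.
have h1 : 2^-1 <= 1 :> R by lra.
have := convex_powR q1 (Itv01 h0 h1).
move=> /(_ a b); rewrite !inE/= !in_itv/= !andbT => /(_ a0 b0) H.
rewrite convRE [X in X `^ _ <= _]convRE/= in H.
have half : unstable.onem 2^-1 = 2^-1 :> R by rewrite /unstable.onem; lra.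
by rewrite half in H; rewrite !mulrDr.
Qed.

(** Dyadic layer cake.  Truncating [F] at [S * 2 ^+ J] makes the induction on [J]
    immediate: passing from [J] to [J + 1] raises the truncation level by
    [S * 2 ^+ J], and only where [F] exceeds the former level. *)
Lemma min_layer_cake (R : realType) (S F : R) (J : nat) : 0 < S ->
  Num.min F (S * 2 ^+ J) <= S + \sum_(j < J) S * 2 ^+ j * (S * 2 ^+ j < F)%R%:R.
Proof.
move=> S0; elim: J => [|J IH]; first by rewrite big_ord0 addr0 mulr1 ge_min lexx orbT.
rewrite big_ord_recr/= addrA; apply: (le_trans _ (lerD IH (lexx _))).
have SJ : 0 < S * 2 ^+ J by rewrite mulr_gt0// exprn_gt0.
rewrite exprS; move: SJ; set a := 2 ^+ J => SJ.
have [lt_F|le_F] := ltP (S * a) F.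
  by rewrite mulr1 ge_min; apply/orP; right; lra.
by rewrite mulr0 addr0 ge_min lexx.
Qed.

Lemma sum_dyadic_shells (R : realType) (r t : R) (K : nat) : 0 <= r ->
  \sum_(k < K) (\1_(`[r / 2 ^+ k / 2, r / 2 ^+ k[%classic : set R) t : R) <=
  (r / 2 ^+ K <= t)%R%:R.
Proof.
move=> r0; elim: K => [|K IH]; first by rewrite big_ord0 ler0n.
rewrite big_ord_recr/=; apply: le_trans (lerD IH (lexx _)) _.
have -> : r / 2 ^+ K / 2 = r / 2 ^+ K.+1 by rewrite exprS; field; rewrite expf_neq0.
have h : r / 2 ^+ K.+1 <= r / 2 ^+ K.
  rewrite ler_wpM2l// lef_pV2 ?posrE ?exprn_gt0// exprS.
  have : 0 < 2 ^+ K :> R by rewrite exprn_gt0.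
  lra.
rewrite indicE mem_setE in_itv/=.
have [tK|tK] := leP (r / 2 ^+ K) t; last by rewrite add0r andbT.
by rewrite andbF addr0 (le_trans h tK).
Qed.

Lemma min1_triangle (R : realType) (a b c : R) :
  Num.min 1 `|c - a| <= Num.min 1 `|b - a| + Num.min 1 `|c - b|.
Proof.
have := ler_normD (b - a) (c - b).
rewrite (_ : b - a + (c - b) = c - a); last lra.
have := normr_ge0 (b - a); have := normr_ge0 (c - b).
by case: (ltP 1 `|c - a|); case: (ltP 1 `|b - a|); case: (ltP 1 `|c - b|) => *;
  lra.
Qed.

(** * Integration lemmas *)

Lemma measurable_preimage d1 d2 (T1 : measurableType d1) (T2 : measurableType d2)
  (f : T1 -> T2) (A : set T2) : measurable_fun setT f -> measurable A ->
  measurable (f @^-1` A).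
Proof. by move=> mf mA; rewrite -[X in measurable X]setTI; exact: mf. Qed.

(** Change of variables for a map that transports [m1] to a multiple of [m2]. *)
Lemma ge0_integral_comp_scaled d1 d2 (T1 : measurableType d1)
    (T2 : measurableType d2) (R : realType)
    (m1 : {measure set T1 -> \bar R}) (m2 : {measure set T2 -> \bar R})
    (phi : T1 -> T2) (c : R) (f : T2 -> \bar R) :
    0 <= c -> measurable_fun setT phi ->
    (forall A, measurable A -> m1 (phi @^-1` A) = c%:E * m2 A)%E ->
    measurable_fun setT f -> (forall y, 0 <= f y)%E ->
  (\int[m1]_x f (phi x) = c%:E * \int[m2]_y f y)%E.
Proof.
move=> c0 mphi phiE mf f0; pose k : {nonneg R} := NngNum c0.
have := ge0_integral_pushforward mphi m1 measurableT mf (fun y _ => f0 y).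
rewrite preimage_setT => <-.
transitivity (\int[mscale k m2]_y f y)%E.
  by apply: eq_measure_integral => A mA _; exact: phiE.
exact: (ge0_integral_mscale m2 measurableT k mf (fun x _ => f0 x)).
Qed.

Lemma le_integral_scaled_add d (T : measurableType d) (R : realType)
    (nu : {measure set T -> \bar R}) (c : R) (a b : \bar R)
    (h f1 f2 : T -> \bar R) :
    0 <= c -> measurable_fun setT h -> measurable_fun setT f1 ->
    measurable_fun setT f2 -> (forall z, 0 <= h z)%E -> (forall z, 0 <= f1 z)%E ->
    (forall z, 0 <= f2 z)%E -> (forall z, h z <= c%:E * (f1 z + f2 z))%E ->
    (\int[nu]_z f1 z = a)%E -> (\int[nu]_z f2 z = b)%E ->
  (\int[nu]_z h z <= c%:E * (a + b))%E.
Proof.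
move=> c0 mh mf1 mf2 h0 f10 f20 hle <- <-.
have mD : measurable_fun setT (fun z => f1 z + f2 z)%E by exact: emeasurable_funD.
rewrite -ge0_integralD// -ge0_integralZl_EFin//; last by move=> z _; exact: adde_ge0.
by apply: ge0_le_integral => //; exact: measurable_funeM.
Qed.

Lemma sum_integral_le_indic d (T : measurableType d) (R : realType)
    (nu : {measure set T -> \bar R}) (K J : nat) (h : 'I_K -> T -> R)
    (a : R) (A : set T) (b : 'I_J -> R) (B : 'I_J -> set T) :
    (forall k, measurable_fun setT (h k)) -> (forall k z, 0 <= h k z) ->
    0 <= a -> measurable A -> (forall j, 0 <= b j) -> (forall j, measurable (B j)) ->
    (forall z, \sum_k h k z <= a * \1_A z + \sum_j b j * \1_(B j) z) ->
  (\sum_k \int[nu]_z (h k z)%:E <= a%:E * nu A + \sum_j (b j)%:E * nu (B j))%E.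
Proof.
move=> mh h0 a0 mA b0 mB hle.
have mind c (C : set T) : measurable C ->
    measurable_fun setT (fun z => (c * \1_C z : R)%:E).
  move=> mC; apply/measurable_EFinP; apply: measurable_funM.
    exact: measurable_cst.
  exact: measurable_indic.
have ind0 c (C : set T) z : 0 <= c -> (0 <= (c * \1_C z : R)%:E)%E.
  by move=> c0; rewrite lee_fin mulr_ge0.
have indE c (C : set T) : 0 <= c -> measurable C ->
    (\int[nu]_z (c * \1_C z : R)%:E = c%:E * nu C)%E.
  move=> c0 mC; under eq_integral do rewrite EFinM.
  rewrite ge0_integralZl_EFin//; first by rewrite integral_indic// setIT.
  by apply/measurable_EFinP; exact: measurable_indic.
rewrite -indE//; under [in leRHS]eq_bigr do rewrite -indE//.
rewrite -(ge0_integral_sum nu measurableT (f := fun k z => (h k z)%:E)); first last.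
- by move=> k z _; rewrite lee_fin.
- by move=> k; exact/measurable_EFinP.
rewrite -(ge0_integral_sum nu measurableT
  (f := fun j z => (b j * \1_(B j) z)%:E)); first last.
- by move=> j z _; exact: ind0.
- by move=> j; exact: mind.
rewrite -ge0_integralD//; first last.
- by apply: emeasurable_sum => j; exact: mind.
- by move=> z _; apply: sume_ge0 => j _; exact: ind0.
- exact: mind.
- by move=> z _; exact: ind0.
apply: ge0_le_integral => //.
- by move=> z _; apply: sume_ge0 => k _; rewrite lee_fin.
- by apply: emeasurable_sum => k; exact/measurable_EFinP.
- apply: emeasurable_funD; first exact: mind.
  by apply: emeasurable_sum => j; exact: mind.
- by move=> z _; rewrite !sumEFin -EFinD lee_fin.
Qed.

Lemma integral_eq0_null d (T : measurableType d) (R : realType)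
    (nu : {measure set T -> \bar R}) (h : T -> R) :
    measurable_fun setT h -> (forall z, 0 <= h z) ->
    (\int[nu]_z (h z)%:E = 0)%E ->
  nu.-negligible [set z | 0 < h z].
Proof.
move=> mh h0 ih0.
have mh' : measurable_fun setT (EFin \o h) by exact/measurable_EFinP.
have /(ae_eq_integral_abs nu measurableT mh') : (\int[nu]_x `|(EFin \o h) x| = 0)%E.
  by rewrite -ih0; apply: eq_integral => z _ /=; rewrite ger0_norm.
move=> [A [mA A0 hA]]; exists A; split => // z /= hz; apply: hA => /=.
by move=> /(_ I) -[] hz0; move: hz; rewrite hz0 ltxx.
Qed.

(** * Lebesgue measure, midpoints and products *)

Section lebesgue_rV.
Context (R : realType).

Definition mid (n : nat) (x y : 'rV[R]_n) : 'rV[R]_n := 2^-1 *: (x + y).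

Lemma midE n (x y : 'rV[R]_n) i : mid x y ord0 i = 2^-1 * (x ord0 i + y ord0 i).
Proof. by rewrite !mxE. Qed.

Lemma midC n (x y : 'rV[R]_n) : mid x y = mid y x.
Proof. by rewrite /mid addrC. Qed.

Lemma measurable_midr n (x : 'rV[R]_n) : measurable_fun setT (mid x).
Proof.
apply/measurable_fun_rVP => i.
rewrite (_ : _ \o _ = fun y : 'rV[R]_n => 2^-1 * (x ord0 i + rV_coor i y)); last first.
  by apply/funext => y; rewrite /= /rV_coor !mxE.
apply: measurable_funM => //; apply: measurable_funD => //.
exact: measurable_rV_coor.
Qed.

Lemma lebesgue_measure_midpoint (a : R) (A : set (measurableTypeR R)) :
    measurable A ->
  (lebesgue_measure ((fun t : R => 2^-1 * (a + t))%R @^-1` A) =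
   2%:E * lebesgue_measure A)%E.
Proof.
move=> mA; pose phi (t : measurableTypeR R) : measurableTypeR R := 2^-1 * (a + t).
have mphi : measurable_fun setT phi.
  by apply: measurable_funM => //; exact: measurable_funD.
have [nu nuE] := pushforward_measure (@lebesgue_measure R) mphi.
have k0 : 0 <= 2^-1 :> R by rewrite invr_ge0.
have nuP X : mscale (NngNum k0) nu X = (2^-1%:E * lebesgue_measure (phi @^-1` X))%E.
  by rewrite -[X in (_ * X)%E]/(pushforward _ phi X) nuE.
transitivity (2%:E * mscale (NngNum k0) nu A)%E.
  by rewrite nuP muleA -EFinM mulfV// mul1e.
congr (_ * _)%E; apply/esym; apply: lebesgue_measure_unique => // _ [[b c] _ <-].
rewrite [RHS]nuP/=.
rewrite (_ : phi @^-1` _ = `](2 * b - a), (2 * c - a)]%classic); last first.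
  by apply/seteqP; split => t /=; rewrite /phi !in_itv/= => /andP[? ?];
    apply/andP; split; lra.
rewrite !lebesgue_measure_itv/= !lte_fin.
have -> : (2 * b - a < 2 * c - a) = (b < c) by apply/idP/idP; lra.
case: ifP => _; last by rewrite mule0.
by rewrite -!EFinD -EFinM; congr EFin; lra.
Qed.

Lemma xsection_rV_cons n (A : set 'rV[R]_n.+1) (t : measurableTypeR R) :
  xsection (@rV_cons R n @^-1` A) t = [set y | A (rV_cons (t, y))].
Proof. by apply/seteqP; split => y /=; rewrite /xsection/= inE. Qed.

Lemma borel_lebS n (A : set 'rV[R]_n.+1) :
  borel_leb R n.+1 A =
  (\int[lebesgue_measure]_(t in setT) borel_leb R n [set y | A (rV_cons (t, y))])%E.
Proof.
rewrite /= /pushforward /product_measure1; apply: eq_integral => t _ /=.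
by rewrite xsection_rV_cons.
Qed.

Lemma measurable_borel_leb_slice n (A : set 'rV[R]_n.+1) : measurable A ->
  measurable_fun setT (fun t : measurableTypeR R =>
    borel_leb R n [set y | A (rV_cons (t, y))]).
Proof.
move=> mA; have := @measurable_fun_xsection _ _ _ _ R (borel_leb R n)
  (@rV_cons R n @^-1` A) (measurable_preimage (@measurable_rV_cons R n) mA).
by congr (measurable_fun _ _); apply/funext => t /=; rewrite xsection_rV_cons.
Qed.

(** The Jacobian of [mid x] is [2 ^ -n]: one factor 2 for each coordinate, peeled
    off by induction on the dimension. *)
Lemma borel_leb_mid n (x : 'rV[R]_n) (A : set 'rV[R]_n) : measurable A ->
  (borel_leb R n (mid x @^-1` A) = (2 ^+ n)%:E * borel_leb R n A)%E.
Proof.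
elim: n => [|n IHn] in x A * => mA.
  rewrite expr0 mul1e; congr (borel_leb _ _ _).
  by apply/seteqP; split => y /=; rewrite (_ : mid x y = y)//; apply/rowP => -[].
rewrite !borel_lebS.
pose x' : 'rV[R]_n := \row_i x ord0 (lift ord0 i).
pose phi (t : measurableTypeR R) : measurableTypeR R := 2^-1 * (x ord0 ord0 + t).
have mid_cons t y : mid x (rV_cons (t, y)) = rV_cons (phi t, mid x' y).
  apply/rowP => i; rewrite midE; have [j ->|->] := unliftP ord0 i.
    have := rV_coor_consS (phi t, mid x' y) j; rewrite /rV_coor => ->.
    have := rV_coor_consS (t, y) j; rewrite /rV_coor => ->.
    by rewrite midE mxE.
  have := rV_coor_cons0 (phi t, mid x' y); rewrite /rV_coor => ->.
  by have := rV_coor_cons0 (t, y); rewrite /rV_coor => ->.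
pose h (t : measurableTypeR R) := borel_leb R n [set y | A (rV_cons (t, y))].
have mh : measurable_fun setT h by exact: measurable_borel_leb_slice.
have mA_ t : measurable [set y | A (rV_cons (t, y))].
  rewrite -xsection_rV_cons; apply: measurable_xsection.
  exact: measurable_preimage (@measurable_rV_cons R n) mA.
transitivity (\int[lebesgue_measure]_(t in setT) ((2 ^+ n)%:E * h (phi t)))%E.
  apply: eq_integral => t _; rewrite /h -(IHn x')//; congr (borel_leb _ _ _).
  by apply/seteqP; split => y /=; rewrite mid_cons.
have mphi : measurable_fun setT phi.
  by apply: measurable_funM => //; exact: measurable_funD.
rewrite ge0_integralZl_EFin//.
- rewrite (@ge0_integral_comp_scaled _ _ _ _ _ _ lebesgue_measure phi 2 h)//.
    by rewrite muleA -EFinM exprSr.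
  exact: lebesgue_measure_midpoint.
- exact: measurableT_comp.
Qed.

Lemma measurable_submx (M N : nat) :
  measurable_fun setT (fun z : 'rV[R]_(M + N) => (lsubmx z, rsubmx z)).
Proof.
apply/measurable_fun_pairP; split; apply/measurable_fun_rVP => i.
- rewrite (_ : _ \o _ = rV_coor (lshift N i)); first exact: measurable_rV_coor.
  by apply/funext => z; rewrite /= /rV_coor mxE.
- rewrite (_ : _ \o _ = rV_coor (rshift M i)); first exact: measurable_rV_coor.
  by apply/funext => z; rewrite /= /rV_coor mxE.
Qed.

Lemma borel_leb_rect (M N : nat) (A : set 'rV[R]_M) (B : set 'rV[R]_N) :
    measurable A -> measurable B ->
  (borel_leb R (M + N) [set z | A (lsubmx z) /\ B (rsubmx z)] =
   borel_leb R M A * borel_leb R N B)%E.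
Proof.
elim: M A => [|M IHM] A mA mB.
  have rE (z : 'rV[R]_(0 + N)) : rsubmx z = z.
    by apply/rowP => i; rewrite mxE; congr (z _ _); exact/val_inj.
  have lE (z : 'rV[R]_(0 + N)) : lsubmx z = 0 by apply/rowP => -[].
  rewrite [borel_leb R 0 A]/= diracE; have [A0|nA0] := boolP (0 \in A).
    rewrite mul1e; congr (borel_leb _ _ _).
    by apply/seteqP; split => z /=; rewrite lE rE; [case|move: A0; rewrite inE].
  rewrite mul0e (_ : [set _ | _] = set0) ?measure0//.
  apply/seteqP; split => z //=; rewrite lE => -[A0].
  by move: nA0; rewrite notin_setE.
pose h (t : measurableTypeR R) := borel_leb R M [set y | A (rV_cons (t, y))].
have mh : measurable_fun setT h by exact: measurable_borel_leb_slice.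
transitivity (\int[lebesgue_measure]_(t in setT) (h t * borel_leb R N B))%E.
  rewrite [LHS]borel_lebS; apply: eq_integral => t _; rewrite /h -IHM//; last first.
    rewrite -xsection_rV_cons; apply: measurable_xsection.
    exact: measurable_preimage (@measurable_rV_cons R M) mA.
  congr (borel_leb _ _ _); apply/seteqP.
  have lE (z : 'rV[R]_(M + N)) :
      @lsubmx R 1 M.+1 N (rV_cons (t, z)) = rV_cons (t, lsubmx z).
    apply/rowP => i; rewrite mxE; have [j ->|->] := unliftP ord0 i.
      have -> : lshift N (lift ord0 j) = lift ord0 (lshift N (j : 'I_M)) :> 'I_(M + N).+1
        by exact/val_inj.
      have := rV_coor_consS (t, lsubmx z) j; rewrite /rV_coor => ->.
      have := rV_coor_consS (t, z) (lshift N j); rewrite /rV_coor => ->.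
      by rewrite /= mxE.
    have -> : lshift N (ord0 : 'I_M.+1) = ord0 :> 'I_(M + N).+1 by exact/val_inj.
    have := rV_coor_cons0 (t, lsubmx z); rewrite /rV_coor => ->.
    by have := rV_coor_cons0 (t, z); rewrite /rV_coor => ->.
  have rE (z : 'rV[R]_(M + N)) :
      @rsubmx R 1 M.+1 N (rV_cons (t, z)) = rsubmx z.
    apply/rowP => i; rewrite mxE.
    have -> : rshift M.+1 i = lift ord0 (rshift M i) :> 'I_(M + N).+1 by exact/val_inj.
    have := rV_coor_consS (t, z) (rshift M i); rewrite /rV_coor => ->.
    by rewrite /= mxE.
  by split => z /=; rewrite lE rE.
by rewrite ge0_integralZr// borel_lebS.
Qed.

(** Lebesgue measure on [R^(M + N)] is the product of those on [R^M] and [R^N],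
    which gives access to Tonelli's theorem. *)
Lemma borel_leb_prod (M N : nat) (C : set ('rV[R]_M * 'rV[R]_N)) :
    measurable C ->
  borel_leb R (M + N) [set z | C (lsubmx z, rsubmx z)] =
  (borel_leb R M \x borel_leb R N)%E C.
Proof.
move=> mC.
have [nu nuE] := pushforward_measure (borel_leb R (M + N)) (@measurable_submx M N).
rewrite (@product_measure_unique _ _ _ _ R (borel_leb R M) (borel_leb R N) nu)//.
  by rewrite -nuE.
by move=> A B mA mB; rewrite -nuE; exact: borel_leb_rect.
Qed.

Lemma measurable_ball_rV n (x : 'rV[R]_n) (e : R) : 0 < e ->
  measurable (ball x e).
Proof. by move=> e0; apply: open_measurable_rV; exact: ball_open. Qed.

Lemma borel_leb_ball n (x : 'rV[R]_n) (e : R) : 0 < e ->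
  borel_leb R n (ball x e) = ((e *+ 2) ^+ n)%:E.
Proof.
move=> e0; rewrite (_ : ball x e = [set y | forall i, ball (x ord0 i) e (y ord0 i)]).
  rewrite (@borel_leb_box _ _ (fun i => ball (x ord0 i) e)); last first.
    by move=> i; rewrite ball_itv; exact: measurable_itv.
  under eq_bigr do rewrite lebesgue_measure_ball ?ltW//.
  by rewrite prodEFin prodr_const card_ord.
apply/seteqP; split=> y /=.
  by move=> [_ xy] i; exact: xy.
by move=> xy; split=> // i j; rewrite ord1; exact: xy.
Qed.

End lebesgue_rV.

(** * The Euclidean norm *)

Section euclidean_norm.
Context (R : realType) (n : nat).
Implicit Types x y : 'rV[R]_n.

Lemma enorm_ge0 x : 0 <= enorm x. Proof. exact: sqrtr_ge0. Qed.

Lemma enormZ (a : R) x : 0 <= a -> enorm (a *: x) = a * enorm x.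
Proof.
move=> a0; rewrite /enorm -[in RHS](ger0_norm a0) -sqrtr_sqr -sqrtrM ?sqr_ge0//.
by congr Num.sqrt; rewrite mulr_sumr; apply: eq_bigr => i _; rewrite mxE exprMn.
Qed.

Lemma enorm_distC x y : enorm (x - y) = enorm (y - x).
Proof.
rewrite /enorm; congr Num.sqrt; apply: eq_bigr => i _.
by rewrite !mxE -sqrrN opprB.
Qed.

Lemma enorm_coor x i : `|x ord0 i| <= enorm x.
Proof.
rewrite -sqrtr_sqr ler_sqrt; last by apply: sumr_ge0 => j _; exact: sqr_ge0.
by rewrite (bigD1 i)//= lerDl; apply: sumr_ge0 => j _; exact: sqr_ge0.
Qed.

Lemma enorm_eq0 x : enorm x = 0 -> x = 0.
Proof.
move=> x0; apply/rowP => i; rewrite mxE; apply/eqP; rewrite -normr_le0 -x0.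
exact: enorm_coor.
Qed.

Lemma measurable_enormB :
  measurable_fun setT (fun z : 'rV[R]_n * 'rV[R]_n => enorm (z.2 - z.1)).
Proof.
apply: (measurableT_comp (f := @Num.sqrt R)).
  by apply: continuous_measurable_fun; exact: sqrt_continuous.
apply: measurable_sum => i.
rewrite (_ : (fun _ => _) = fun z : 'rV[R]_n * 'rV[R]_n =>
    (rV_coor i z.2 - rV_coor i z.1 : R) ^+ 2); last first.
  by apply/funext => z; rewrite !mxE.
apply: measurable_funX; apply: measurable_funB.
- exact: measurableT_comp (measurable_rV_coor i) measurable_snd.
- exact: measurableT_comp (measurable_rV_coor i) measurable_fst.
Qed.

Lemma enormB_gt0 x y : x <> y -> 0 < enorm (y - x).
Proof.
move=> xy; rewrite lt_neqAle enorm_ge0 andbT eq_sym; apply/eqP => /enorm_eq0/eqP.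
by rewrite subr_eq0 => /eqP yx; exact: xy.
Qed.

End euclidean_norm.

(** * Change of variables to the midpoint *)

Section midpoint.
Context (R : realType) (n : nat).
Implicit Types x y : 'rV[R]_n.

Lemma mid_subl x y : mid x y - x = 2^-1 *: (y - x).
Proof. by apply/rowP => i; rewrite !mxE; lra. Qed.

Lemma mid_subr x y : mid x y - y = 2^-1 *: (x - y).
Proof. by rewrite midC mid_subl. Qed.

Lemma measurable_mid :
  measurable_fun setT (fun z : 'rV[R]_n * 'rV[R]_n => mid z.1 z.2).
Proof.
apply/measurable_fun_rVP => i.
rewrite (_ : _ \o _ = fun z : 'rV[R]_n * 'rV[R]_n =>
    2^-1 * (rV_coor i z.1 + rV_coor i z.2 : R)); last first.
  by apply/funext => z; rewrite /= /rV_coor midE.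
apply: measurable_funM => //; apply: measurable_funD.
- exact: measurableT_comp (measurable_rV_coor i) measurable_fst.
- exact: measurableT_comp (measurable_rV_coor i) measurable_snd.
Qed.

Local Notation mu := (borel_leb R n).

Lemma integral_midl (f : 'rV[R]_n * 'rV[R]_n -> \bar R) :
    measurable_fun setT f -> (forall z, 0 <= f z)%E ->
  (\int[mu \x mu]_z f (z.1, mid z.1 z.2) =
   (2 ^+ n)%:E * \int[mu \x mu]_z f z)%E.
Proof.
move=> mf f0.
have mfm : measurable_fun setT (fun z => f (z.1, mid z.1 z.2)).
  apply: (measurableT_comp mf); apply: measurable_fun_pair; first exact: measurable_fst.
  exact: measurable_mid.
rewrite fubini_tonelli1// [in RHS]fubini_tonelli1// /fubini_F.
rewrite -ge0_integralZl_EFin//; last 2 first.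
- by move=> x _; exact: integral_ge0.
- exact: measurable_fun_fubini_tonelli_F.
apply: eq_integral => x _ /=.
rewrite (@ge0_integral_comp_scaled _ _ _ _ _ mu mu (mid x) (2 ^+ n) (fun y => f (x, y)))//.
- exact: measurable_midr.
- by move=> A; exact: borel_leb_mid.
- exact: measurableT_comp.
Qed.

(** By [midC] and Tonelli's theorem, this is [integral_midl] with the two points
    exchanged. *)
Lemma integral_midr (f : 'rV[R]_n * 'rV[R]_n -> \bar R) :
    measurable_fun setT f -> (forall z, 0 <= f z)%E ->
  (\int[mu \x mu]_z f (z.2, mid z.1 z.2) =
   (2 ^+ n)%:E * \int[mu \x mu]_z f z)%E.
Proof.
move=> mf f0; rewrite -integral_midl//.
have mfm : measurable_fun setT (fun z => f (z.1, mid z.1 z.2)).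
  apply: (measurableT_comp mf); apply: measurable_fun_pair; first exact: measurable_fst.
  exact: measurable_mid.
have mfm' : measurable_fun setT (fun z => f (z.2, mid z.1 z.2)).
  apply: (measurableT_comp mf); apply: measurable_fun_pair; first exact: measurable_snd.
  exact: measurable_mid.
rewrite (@fubini_tonelli2 _ _ _ _ _ mu mu _ mfm' (fun z => f0 _)).
rewrite (@fubini_tonelli1 _ _ _ _ _ mu mu _ mfm (fun z => f0 _)).
apply: eq_integral => x _; rewrite /fubini_F /fubini_G/=.
by apply: eq_integral => y _; rewrite midC.
Qed.

End midpoint.

Lemma ball_mid (R : realType) (N : nat) (x y z : 'rV[R]_N) (e : R) :
  ball x e y -> ball x e z -> ball x e (mid y z).
Proof.
move=> [e0 xy] [_ xz]; split=> // i j; rewrite ord1 midE.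
move: (xy ord0 j) (xz ord0 j); rewrite /ball/=.
rewrite !ltr_norml => /andP[? ?] /andP[? ?]; apply/andP; split; lra.
Qed.

(** * Monotonicity of the dyadic energies *)

Section midpoint_monotonicity.
Context (R : realType) (N : nat) (q : R).
Variables (Q : set 'rV[R]_N) (g : 'rV[R]_N -> R).
Hypotheses (q1 : 1 <= q) (mQ : measurable Q) (mg : measurable_fun setT g).
Local Notation V := ('rV[R]_N * 'rV[R]_N)%type.
Local Notation mu := (borel_leb R N).

(** Truncating the increments at 1 keeps the quotient bounded away from the
    diagonal without any bound on [g]; [min 1 `|a - b|] still satisfies the
    triangle inequality, and it vanishes only when [a = b]. *)
Definition trunc_quot (z : V) : R :=
  Num.min 1 `|g z.2 - g z.1| `^ q / enorm (z.2 - z.1) `^ (q + N%:R).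

Definition shell_quot (r : R) (z : V) : R :=
  \1_(Q `*` Q) z * (\1_(`[r / 2, r[%classic) (enorm (z.2 - z.1)) * trunc_quot z).

Definition superlevel (s : R) : set V := (Q `*` Q) `&` [set z | s < trunc_quot z].

Lemma trunc_quot_ge0 z : 0 <= trunc_quot z.
Proof. by rewrite divr_ge0// powR_ge0. Qed.

Lemma shell_quot_ge0 r z : 0 <= shell_quot r z.
Proof. by apply: mulr_ge0 => //; apply: mulr_ge0 => //; exact: trunc_quot_ge0. Qed.

Lemma shell_quotE r z : Q z.1 -> Q z.2 -> r / 2 <= enorm (z.2 - z.1) < r ->
  shell_quot r z = trunc_quot z.
Proof.
move=> Q1 Q2 rz; rewrite /shell_quot !indicE (mem_set (conj Q1 Q2 : (Q `*` Q) z)).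
by rewrite mem_setE in_itv/= rz !mul1r.
Qed.

Lemma measurable_trunc_quot : measurable_fun setT trunc_quot.
Proof.
rewrite (_ : trunc_quot = fun z : V => Num.min 1 `|g z.2 - g z.1| `^ q *
    enorm (z.2 - z.1) `^ - (q + N%:R)); last by apply/funext => z; rewrite powRN.
apply: measurable_funM; last first.
  apply: (measurableT_comp (f := fun t : R => t `^ - (q + N%:R))).
    exact: measurable_powR.
  exact: measurable_enormB.
apply: (measurableT_comp (f := fun t : R => t `^ q)); first exact: measurable_powR.
apply: measurable_minr; first exact: measurable_cst.
apply: (measurableT_comp (f := @Num.norm _ R)); first exact: normr_measurable.
apply: measurable_funB.
- exact: measurableT_comp mg measurable_snd.
- exact: measurableT_comp mg measurable_fst.
Qed.

Lemma measurable_shell_quot r : measurable_fun setT (shell_quot r).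
Proof.
apply: measurable_funM; first by apply: measurable_indic; exact: measurableX.
apply: measurable_funM; last exact: measurable_trunc_quot.
apply: (measurableT_comp (f := \1_(`[r / 2, r[%classic) : R -> R)).
  by apply: measurable_indic; exact: measurable_itv.
exact: measurable_enormB.
Qed.

Lemma measurable_superlevel s : measurable (superlevel s).
Proof.
apply: measurableI; first exact: measurableX.
have -> : [set z | s < trunc_quot z] = trunc_quot @^-1` `]s, +oo[.
  by apply/seteqP; split => z /=; rewrite in_itv/= andbT.
exact: measurable_preimage measurable_trunc_quot (measurable_itv _).
Qed.

Lemma trunc_quot_sym x y : trunc_quot (x, y) = trunc_quot (y, x).
Proof. by rewrite /trunc_quot/= distrC enorm_distC. Qed.

(** Halving both the increment and the distance divides numerator and denominator
    by the same [2 ^ q], which leaves a gain of [2 ^- N] from the exponent [N];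
    the factor [2^-1] comes from convexity. *)
Lemma trunc_quot_mid x y :
  trunc_quot (x, y) <=
  2^-1 * (2 ^- N * (trunc_quot (x, mid x y) + trunc_quot (y, mid x y))).
Proof.
rewrite [trunc_quot (y, _)]trunc_quot_sym /trunc_quot/=.
have -> : enorm (y - mid x y) = 2^-1 * enorm (y - x).
  by rewrite enorm_distC mid_subr enormZ ?invr_ge0// enorm_distC.
rewrite mid_subl enormZ ?invr_ge0// -mulrDl.
set a := Num.min 1 `|g (mid x y) - g x|.
set b := Num.min 1 `|g y - g (mid x y)|.
set o := Num.min 1 _; set t := enorm _.
have t0 : 0 <= t by exact: enorm_ge0.
have a0 : 0 <= a by rewrite le_min ler01 normr_ge0.
have b0 : 0 <= b by rewrite le_min ler01 normr_ge0.
have o0 : 0 <= o by rewrite le_min ler01 normr_ge0.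
have oab : o <= a + b by exact: min1_triangle.
have q0 : 0 <= q by exact: le_trans ler01 q1.
have half : 2^-1 `^ (q + N%:R) = (2 `^ q * 2 ^+ N)^-1 :> R.
  rewrite -(@powR_inv1 _ 2)// -powRrM mulN1r powRN powRD; last by apply/implyP.
  by rewrite powR_mulrn.
have -> : 2^-1 * (2 ^- N * ((a `^ q + b `^ q) / (2^-1 * t) `^ (q + N%:R))) =
    2 `^ q * (2^-1 * (a `^ q + b `^ q)) / t `^ (q + N%:R).
  rewrite powRM ?invr_ge0// half invfM invrK.
  have : 2 ^+ N != 0 :> R by rewrite expf_neq0.
  set X := 2 ^+ N => X0; set Y := (t `^ _)^-1; field.
  exact: X0.
rewrite ler_wpM2r ?invr_ge0 ?powR_ge0//.
apply: (@le_trans _ _ (2 `^ q * (2^-1 * (a + b)) `^ q)).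
  rewrite -powRM//; last by rewrite mulr_ge0 ?invr_ge0// addr_ge0.
  by rewrite ge0_ler_powR ?nnegrE//; lra.
by rewrite ler_wpM2l ?powR_ge0// powR_midpoint_le.
Qed.

Hypothesis Qmid : forall x y, Q x -> Q y -> Q (mid x y).

Lemma shell_quot_mid r x y : shell_quot r (x, y) <=
  2^-1 * (2 ^- N *
    (shell_quot (r / 2) (x, mid x y) + shell_quot (r / 2) (y, mid x y))).
Proof.
have rhs0 : 0 <= 2^-1 * (2 ^- N * (shell_quot (r / 2) (x, mid x y) +
    shell_quot (r / 2) (y, mid x y))).
  by rewrite !mulr_ge0 ?invr_ge0 ?exprn_ge0// addr_ge0 ?shell_quot_ge0.
rewrite {1}/shell_quot indicE.
have [|] := boolP ((x, y) \in Q `*` Q); last by rewrite mul0r.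
rewrite inE => -[/= Qx Qy]; rewrite mul1r indicE mem_setE in_itv/=.
case: (boolP (_ && _)); last by rewrite mul0r.
move=> /andP[rt tr]; rewrite mul1r; apply: le_trans (trunc_quot_mid x y) _.
have Qm := Qmid Qx Qy.
have rm : r / 2 / 2 <= 2^-1 * enorm (y - x) < r / 2.
  by rewrite [r / 2 / 2]mulrC [r / 2 in ltRHS]mulrC ler_pM2l ?ltr_pM2l ?invr_gt0// rt.
have -> : shell_quot (r / 2) (x, mid x y) = trunc_quot (x, mid x y).
  by apply: shell_quotE; rewrite //= mid_subl enormZ ?invr_ge0.
have -> : shell_quot (r / 2) (y, mid x y) = trunc_quot (y, mid x y).
  by apply: shell_quotE; rewrite //= mid_subr enormZ ?invr_ge0// enorm_distC.
exact: lexx.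
Qed.

Definition shell_energy r : \bar R := (\int[mu \x mu]_z (shell_quot r z)%:E)%E.

Lemma shell_energy_ge0 r : (0 <= shell_energy r)%E.
Proof. by apply: integral_ge0 => z _; rewrite lee_fin shell_quot_ge0. Qed.

(** The gain [2^-1 * 2 ^- N] of [trunc_quot_mid] is exactly compensated by the two
    terms and by the Jacobian [2 ^ N] of the midpoint map. *)
Lemma shell_energy_half r : (shell_energy r <= shell_energy (r / 2))%E.
Proof.
pose f z := (shell_quot (r / 2) z)%:E.
have mf : measurable_fun setT f by apply/measurable_EFinP; exact: measurable_shell_quot.
have f0 z : (0 <= f z)%E by rewrite lee_fin shell_quot_ge0.
have m1 : measurable_fun setT (fun z : V => f (z.1, mid z.1 z.2)).
  apply: (measurableT_comp mf); apply: measurable_fun_pair; first exact: measurable_fst.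
  exact: measurable_mid.
have m2 : measurable_fun setT (fun z : V => f (z.2, mid z.1 z.2)).
  apply: (measurableT_comp mf); apply: measurable_fun_pair; first exact: measurable_snd.
  exact: measurable_mid.
have c0 : 0 <= 2^-1 * 2 ^- N :> R by rewrite mulr_ge0 ?invr_ge0 ?exprn_ge0.
have mh : measurable_fun setT (fun z : V => (shell_quot r z)%:E).
  by apply/measurable_EFinP; exact: measurable_shell_quot.
have h0 z : (0 <= (shell_quot r z)%:E)%E by rewrite lee_fin; exact: shell_quot_ge0.
have hle z : ((shell_quot r z)%:E <= (2^-1 * 2 ^- N)%:E *
    (f (z.1, mid z.1 z.2) + f (z.2, mid z.1 z.2)))%E.
  by case: z => x y; rewrite -EFinD -EFinM lee_fin -mulrA; exact: shell_quot_mid.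
have := le_integral_scaled_add c0 mh m1 m2 h0 (fun z => f0 _) (fun z => f0 _)
  hle (integral_midl mf f0) (integral_midr mf f0).
rewrite -/(shell_energy r) -/(shell_energy (r / 2)).
have e0 := shell_energy_ge0 (r / 2).
have N0 : (0 <= (2 ^+ N)%:E :> \bar R)%E by rewrite lee_fin exprn_ge0.
rewrite -ge0_muleDl//.
rewrite muleA -EFinD -EFinM (_ : 2^-1 * _ * _ = 1); first by rewrite mul1e.
have : 2 ^+ N != 0 :> R by rewrite expf_neq0.
by set X := 2 ^+ N => X0; field.
Qed.

Lemma shell_energy_dyadic r k : (shell_energy r <= shell_energy (r / 2 ^+ k))%E.
Proof.
elim: k => [|k IH]; first by rewrite expr0 divr1.
apply: le_trans IH _; apply: le_trans (shell_energy_half _) _.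
by rewrite exprSr invfM mulrA.
Qed.

End midpoint_monotonicity.

(** * Vanishing of the dyadic energies *)

Section vanishing_energy.
Context (R : realType) (N : nat) (q : R).
Variables (Q : set 'rV[R]_N) (g : 'rV[R]_N -> R).
Hypotheses (q1 : 1 <= q) (mQ : measurable Q) (mg : measurable_fun setT g).
Local Notation mu := (borel_leb R N).

(** Away from the diagonal the quotient is at most the inverse of its denominator;
    the power of [2 ^ K] in that bound is rounded up to the integer [K * p]. *)
Lemma trunc_quot_le (r S : R) (K p J : nat) (z : 'rV[R]_N * 'rV[R]_N) :
    0 < r -> q + N%:R <= p%:R -> r `^ (- (q + N%:R)) <= S * 2 ^+ J ->
    r / 2 ^+ K <= enorm (z.2 - z.1) ->
  trunc_quot q g z <= S * 2 ^+ (J + K * p).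
Proof.
move=> r0 qp rS rt; have qN0 : 0 <= q + N%:R by rewrite addr_ge0// (le_trans ler01 q1).
have K0 : 0 < 2 ^+ K :> R by rewrite exprn_gt0.
have rK : 0 < r / 2 ^+ K by rewrite divr_gt0.
apply: (@le_trans _ _ (1 / (r / 2 ^+ K) `^ (q + N%:R))).
  apply: ler_pM; rewrite ?powR_ge0 ?invr_ge0 ?powR_ge0//.
    apply: (@le_trans _ _ (1 `^ q)); last by rewrite powR1.
    apply: ge0_ler_powR; rewrite ?nnegrE ?le_min ?ler01 ?normr_ge0 ?ge_min ?lexx//.
    exact: le_trans ler01 q1.
  rewrite lef_pV2 ?posrE ?powR_gt0//; last exact: lt_le_trans rK rt.
  rewrite ge0_ler_powR ?nnegrE//; first exact: ltW.
  exact: enorm_ge0.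
have K0' := ltW K0; rewrite div1r -powRN powRM ?invr_ge0//; last exact: ltW.
rewrite exprD mulrA; apply: ler_pM; rewrite ?powR_ge0//.
rewrite -powR_inv1// -powRrM mulN1r opprK exprM -powR_mulrn//.
by rewrite ler_powR// exprn_ege1// ler1n.
Qed.

Lemma sum_shell_quot_le (r S : R) (K J : nat) z : 0 < r -> 0 < S ->
    (r / 2 ^+ K <= enorm (z.2 - z.1) -> trunc_quot q g z <= S * 2 ^+ J) ->
  \sum_(k < K) shell_quot q Q g (r / 2 ^+ k) z <=
  S * \1_(Q `*` Q) z +
  \sum_(j < J) S * 2 ^+ j * \1_(superlevel q Q g (S * 2 ^+ j)) z.
Proof.
move=> r0 S0 zle; rewrite /shell_quot -mulr_sumr -mulr_suml.
have [Qz|nQz] := boolP (z \in Q `*` Q); last first.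
  rewrite indicE (negbTE nQz) mul0r mulr0 add0r.
  by apply: sumr_ge0 => j _; rewrite !mulr_ge0 ?(ltW S0).
rewrite [in X in X * _ <= _]indicE [in X in _ <= _ * X + _]indicE Qz mulr1 mul1r.
have := sum_dyadic_shells (enorm (z.2 - z.1)) K (ltW r0).
have [rt|_] := leP (r / 2 ^+ K) (enorm (z.2 - z.1)) => sle; last first.
  apply: (@le_trans _ _ 0).
    by rewrite mulr_le0_ge0 ?trunc_quot_ge0.
  by rewrite addr_ge0 ?mulr_ge0 ?(ltW S0)//; apply: sumr_ge0 => j _;
      rewrite !mulr_ge0 ?(ltW S0).
apply: (@le_trans _ _ (trunc_quot q g z)).
  by rewrite -[leRHS]mul1r ler_wpM2r// trunc_quot_ge0.
have := min_layer_cake (trunc_quot q g z) J S0; rewrite (min_l (zle rt)).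
move/le_trans; apply.
rewrite lerD2l; apply: ler_sum => j _; rewrite ler_wpM2l//.
  by rewrite mulr_ge0// ltW.
rewrite indicE; case: (ltP _ (trunc_quot q g z)) => // Sq.
by rewrite mem_set//; split => //; rewrite inE in Qz.
Qed.

Hypothesis Qmid : forall x y, Q x -> Q y -> Q (mid x y).
Hypothesis Qfin : (mu Q < +oo)%E.
Hypothesis weak : forall eta : R, 0 < eta -> exists2 S : R, 0 < S &
  forall s, S <= s -> (s%:E * (mu \x mu) (superlevel q Q g s) <= eta%:E)%E.

(** [K] shells of energy at least that of the first one share an integral which
    grows like [K * p * eta]: the quotient on them is at most [S * 2 ^+ (J + K * p)],
    so only [J + K * p] dyadic thresholds occur, each contributing at most [eta]. *)
Lemma shell_energy_bound (eta : R) (r : R) : 0 < eta -> 0 < r ->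
  exists C : R, forall K : nat,
    (K%:R%:E * shell_energy q Q g r <=
     (C + K%:R * (Num.truncn (q + N%:R)).+1%:R * eta)%:E)%E.
Proof.
move=> eta0 r0; have [S S0 SP] := weak eta0.
set p := (Num.truncn (q + N%:R)).+1.
have qN0 : 0 <= q + N%:R by rewrite addr_ge0// (le_trans ler01 q1).
have qp : q + N%:R <= p%:R by apply: ltW; exact: truncnS_gt.
have [J rJ] : exists J : nat, r `^ (- (q + N%:R)) <= S * 2 ^+ J.
  exists (Num.truncn (r `^ (- (q + N%:R)) / S)).+1.
  rewrite mulrC -ler_pdivrMr//; apply: le_trans (ltW (truncnS_gt _)) _.
  by rewrite -natrX ler_nat ltnW// ltn_expl.
have [w w0 Qw] : exists2 w, 0 <= w & mu Q = w%:E.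
  exists (fine (mu Q)); first exact: fine_ge0.
  by rewrite fineK// ge0_fin_numE.
exists (S * (w * w) + J%:R * eta) => K; pose JK := (J + K * p)%N.
have mQQ : measurable (Q `*` Q) by exact: measurableX.
have mh k : measurable_fun setT (shell_quot q Q g (r / 2 ^+ k)).
  exact: measurable_shell_quot.
have hle z := @sum_shell_quot_le r S K JK z r0 S0 (@trunc_quot_le r S K p J z r0 qp rJ).
have := sum_integral_le_indic (mu \x mu)%E (fun k : 'I_K => mh k)
  (fun k z => shell_quot_ge0 q Q g _ z) (ltW S0) mQQ
  (fun j : 'I_JK => ltW (mulr_gt0 S0 (exprn_gt0 j (ltr0Sn R 1))))
  (fun j => measurable_superlevel q mQ mg _) hle.
set lhs := (X in (X <= _)%E -> _); move=> le1.
have QQE : ((mu \x mu) (Q `*` Q) = (w * w)%:E)%E.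
  by rewrite EFinM -Qw; exact: product_measure1E.
have {}le1 : (lhs <= S%:E * (w * w)%:E + \sum_(j < JK) (S * 2 ^+ j)%:E *
    (mu \x mu) (superlevel q Q g (S * 2 ^+ j)))%E by rewrite -QQE; exact: le1.
apply: (@le_trans _ _ lhs).
  have -> : K%:R%:E = (\sum_(k < K) 1%:E)%E :> \bar R.
    by rewrite sumEFin sumr_const card_ord.
  rewrite ge0_sume_distrl//; apply: lee_sum => k _; rewrite mul1e.
  exact: shell_energy_dyadic.
apply: (le_trans le1).
rewrite -EFinM -addrA EFinD leeD2l//.
apply: (@le_trans _ _ (\sum_(j < JK) eta%:E)%E).
  apply: lee_sum => j _; apply: SP.
  by rewrite ler_peMr ?(ltW S0)// exprn_ege1// ler1n.
rewrite sumEFin lee_fin sumr_const card_ord -[leLHS]mulr_natl natrD natrM.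
by rewrite mulrDl.
Qed.

Lemma shell_energy_eq0 r : 0 < r -> shell_energy q Q g r = 0%E.
Proof.
move=> r0; have I0 := shell_energy_ge0 q Q g r.
have [C1 /(_ 1%N)] := shell_energy_bound ltr01 r0.
case: (shell_energy q Q g r) I0
  (fun eta (h : 0 < eta) => shell_energy_bound h r0) => [i| |]//; last first.
  by rewrite mul1e.
rewrite lee_fin => i0 ibnd _; congr EFin; apply/eqP; rewrite eq_le i0 andbT leNgt.
apply/negP => ipos; set p : R := (Num.truncn (q + N%:R)).+1%:R in ibnd.
have p0 : 0 < p by rewrite ltr0n.
(* For this eta the slope p * eta of the bound is half the energy i. *)
have [|C CP] := ibnd (i / (2 * p)); first by rewrite divr_gt0// mulr_gt0.
pose K := (Num.truncn (2 * C / i)).+1.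
have KC : 2 * C / i < K%:R by exact: truncnS_gt.
have := CP K; rewrite -EFinM lee_fin.
rewrite ltr_pdivrMr// in KC.
have -> : K%:R * p * (i / (2 * p)) = K%:R * i / 2 by field; rewrite gt_eqF.
lra.
Qed.

Lemma trunc_quot_gt0 z : g z.1 <> g z.2 -> 0 < trunc_quot q g z.
Proof.
move=> gz; have z12 : 0 < enorm (z.2 - z.1).
  by apply: enormB_gt0 => z12; apply: gz; rewrite z12.
rewrite divr_gt0 ?powR_gt0// lt_min ltr01/= normr_gt0 subr_eq0.
by apply/eqP => /esym.
Qed.

(** The shells of rational radii cover the complement of the diagonal. *)
Lemma negligible_neq :
  (mu \x mu)%E.-negligible ((Q `*` Q) `&` [set z | g z.1 <> g z.2]).
Proof.
pose B n : set ('rV[R]_N * 'rV[R]_N) :=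
  if unpickle n is Some r then
    if (0 < ratr r :> R) then [set z | 0 < shell_quot q Q g (ratr r) z] else set0
  else set0.
apply: (@negligibleS _ _ _ _ (\bigcup_n B n)).
  move=> z [[Q1 Q2] /= gz]; have qz := trunc_quot_gt0 gz.
  have z12 : 0 < enorm (z.2 - z.1).
    by apply: enormB_gt0 => z12; apply: gz; rewrite z12.
  have : enorm (z.2 - z.1) < 2 * enorm (z.2 - z.1) by lra.
  move=> /rat_in_itvoo[r]; rewrite in_itv/= => /andP[r1 r2].
  exists (pickle r); first exact: I.
  rewrite /B pickleK.
  have -> : (0 < ratr r :> R) = true by exact: lt_trans z12 r1.
  by rewrite /= shell_quotE// r1 andbT ler_pdivrMr// mulrC ltW.
apply: negligible_bigcup => n; rewrite /B.
case: unpickle => [r|]; last exact: negligible_set0.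
case: ifPn => [r0|_]; last exact: negligible_set0.
apply: integral_eq0_null; last exact: shell_energy_eq0.
- exact: measurable_shell_quot.
- by move=> z; exact: shell_quot_ge0.
Qed.

Lemma ae_constant_of_negligible_neq : (0 < mu Q)%E ->
  exists c, mu.-negligible (Q `&` [set y | g y <> c]).
Proof.
move=> Q0; have [D [mD D0 QD]] := negligible_neq.
have mx x : measurable (xsection D x) by exact: measurable_xsection.
pose h x := mu (xsection D x).
have mh : measurable_fun setT h by exact: measurable_fun_xsection.
have /(ae_eq_integral_abs mu measurableT mh) : (\int[mu]_x `|h x| = 0)%E.
  rewrite -D0 /product_measure1; apply: eq_integral => x _ /=.
  by rewrite gee0_abs// measure_ge0.
move=> [Z [mZ Z0 hZ]].
have [x [Qx Zx]] : exists x, Q x /\ ~ Z x.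
  apply: contrapT => nx; move: Q0; apply/negP; rewrite -leNgt -Z0.
  apply: le_measure; rewrite ?inE// => x Qx; apply: contrapT => Zx; apply: nx.
  by exists x.
have hx0 : h x = 0%E by apply: contrapT => hx; apply: Zx; apply: hZ => /= /(_ I).
exists (g x); exists (xsection D x); split => // y [Qy /= gyx].
by rewrite /xsection/= inE; apply: QD; split => //= /esym.
Qed.

End vanishing_energy.

(** * From local to global constancy *)

Section locally_constant.
Context (R : realType) (N : nat).
Local Notation mu := (borel_leb R N).

Lemma rational_ball_between (x : 'rV[R]_N) (e : R) : 0 < e ->
  exists (p : 'rV[rat]_N) (k : nat), let B := ball (map_mx ratr p : 'rV[R]_N) k.+1%:R^-1 in
    B x /\ B `<=` ball x e.
Proof.
move=> e0; have e20 : 0 < e / 2 by rewrite divr_gt0.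
have [k ke] : exists k : nat, k.+1%:R^-1 < e / 2.
  by have [k] := @ltr_add_invr R 0 (e / 2) e20; rewrite add0r; exists k.
have /choice[p pP] : forall i, exists r : rat, ball (x ord0 i) k.+1%:R^-1 (ratr r : R).
  move=> i; have : x ord0 i - k.+1%:R^-1 < x ord0 i + k.+1%:R^-1.
    by rewrite ltrD2l (@lt_trans _ _ 0)// ?oppr_lt0 invr_gt0.
  by move=> /rat_in_itvoo[r rI]; exists r; rewrite ball_itv.
have px : ball (map_mx ratr (\row_i p i) : 'rV[R]_N) k.+1%:R^-1 x.
  split=> [|i j]; first by rewrite invr_gt0.
  by rewrite !mxE ord1; apply: ball_sym; exact: pP.
exists (\row_i p i), k; split=> // y py.
rewrite [e]splitr; apply: ball_triangle (le_ball (ltW ke) py).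
exact/ball_sym/(le_ball (ltW ke)).
Qed.

Variables (Omega : set 'rV[R]_N) (T : Type) (f : 'rV[R]_N -> T).

Definition ae_const_near (c : T) : set 'rV[R]_N :=
  [set x | exists2 e : R, 0 < e & mu.-negligible (ball x e `&` [set y | f y <> c])].

Lemma ae_const_near_open c : open (ae_const_near c).
Proof.
rewrite openE => x [e e0 ec]; apply/nbhs_ballP; exists (e / 2) => /=.
  by rewrite divr_gt0.
move=> y xy; exists (e / 2); first by rewrite divr_gt0.
apply: negligibleS ec => z [yz fz]; split=> //.
by rewrite [e]splitr; exact: ball_triangle xy yz.
Qed.

(** Two balls with the same centre share a ball, whose measure is positive. *)
Lemma ae_const_near_inj c c' x : ae_const_near c x -> ae_const_near c' x -> c = c'.
Proof.
move=> [e e0 ec] [e' e'0 ec']; apply: contrapT => cc'.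
pose m := Num.min e e'; have m0 : 0 < m by rewrite lt_min e0.
suff /(measure_negligible (measurable_ball_rV x m0)) : mu.-negligible (ball x m).
  move=> ball0; have /eqP := etrans (esym (borel_leb_ball x m0)) ball0.
  by rewrite eqe gt_eqF// exprn_gt0// mulrn_wgt0.
apply: negligibleS (negligibleU ec ec') => y xy.
have [fy|fy] := pselect (f y = c); [right|left]; split.
- by apply: le_ball xy; rewrite ge_min lexx orbT.
- by rewrite /= fy.
- by apply: le_ball xy; rewrite ge_min lexx.
- by [].
Qed.

(** Lindelof argument: countably many rational balls suffice to cover [Omega]. *)
Lemma negligible_of_locally (c : T) : Omega `<=` ae_const_near c ->
  mu.-negligible (Omega `&` [set y | f y <> c]).
Proof.
move=> Oc; pose B (z : 'rV[rat]_N * nat) : set 'rV[R]_N :=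
  ball (map_mx ratr z.1 : 'rV[R]_N) z.2.+1%:R^-1 `&` [set y | f y <> c].
pose h n := if unpickle n is Some z then
  if `[< mu.-negligible (B z) >] then B z else set0 else set0.
apply: (@negligibleS _ _ _ _ (\bigcup_n h n)).
  move=> x [/Oc[e e0 ec] fx].
  have [p [k [px pe]]] := rational_ball_between x e0.
  exists (pickle (p, k)); first exact: I.
  rewrite /h pickleK; case: asboolP => [_|]; first by split.
  by case; apply: negligibleS ec => y [py fy]; split => //; exact: pe.
apply: negligible_bigcup => n; rewrite /h.
case: unpickle => [z|]; last exact: negligible_set0.
by case: asboolP => // _; exact: negligible_set0.
Qed.

(** The sets where [f] is locally a given constant are open, pairwise disjoint, and
    cover [Omega], so one of them contains it.  The value [c0] is the constant
    returned when [Omega] is empty. *)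
Lemma ae_constant_of_locally (c0 : T) : connected Omega ->
    (forall x, Omega x -> exists c, ae_const_near c x) ->
  exists c, mu.-negligible (Omega `&` [set y | f y <> c]).
Proof.
move=> conn loc; have [[x0 Ox0]|O0] := pselect (Omega !=set0); last first.
  exists c0; apply: negligibleS (negligible_set0 _) => x [Ox _].
  by apply: O0; exists x.
have [c cx0] := loc _ Ox0; exists c; apply: negligible_of_locally.
have OE : Omega `&` ae_const_near c = Omega.
  apply: conn.
  - by exists x0.
  - by exists (ae_const_near c) => //; exact: ae_const_near_open.
  - exists (~` \bigcup_(c' in [set c' | c' <> c]) ae_const_near c').
      by apply: open_closedC; apply: bigcup_open => c' _; exact: ae_const_near_open.
    apply/seteqP; split=> x [Ox cx]; split=> //.
      by move=> [c' /= c'c cx']; apply: c'c; exact: ae_const_near_inj cx' cx.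
    have [c' cx'] := loc _ Ox; have [<-//|c'c] := pselect (c' = c).
    by exfalso; apply: cx; exists c'.
by rewrite -OE => x [].
Qed.

End locally_constant.

(** * The coordinates of the map *)

Section coordinate.
Context (R : realType) (N m : nat) (Omega : set 'rV[R]_N) (q : R).
Variable (u : 'rV[R]_N -> 'rV[R]_m).
Hypotheses (hopen : open Omega) (q1 : 1 <= q).

Definition quotient_set (s : R) : set 'rV[R]_(N + N) :=
  [set z : 'rV[R]_(N + N) | let x := lsubmx z in let y := rsubmx z in
     [/\ Omega x, Omega y &
       (s < enorm (u y - u x) `^ q / enorm (y - x) `^ (q + N%:R))%R]].

(** Replacing [u] by the Borel representative [g] of a coordinate and truncating only
    decrease the superlevel sets, up to the null set of pairs with a point in [H]. *)
Lemma superlevel_le (Q H : set 'rV[R]_N) (g : 'rV[R]_N -> R) (i : 'I_m) (s : R) :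
    measurable Q -> measurable H -> borel_leb R N H = 0%E ->
    measurable_fun setT g -> Q `<=` Omega ->
    (forall x, Omega x -> ~ H x -> g x = u x ord0 i) ->
  ((borel_leb R N \x borel_leb R N) (superlevel q Q g s) <=
   leb R (N + N) (quotient_set s))%E.
Proof.
move=> mQ mH H0 mg QO gu; set mu := borel_leb R N.
pose E := superlevel q Q g s; pose Z := H `*` setT `|` setT `*` H.
have mE : measurable E by exact: measurable_superlevel.
have mZ1 : measurable (H `*` [set: 'rV[R]_N]) by exact: measurableX.
have mZ2 : measurable ([set: 'rV[R]_N] `*` H) by exact: measurableX.
have mZ : measurable Z by exact: measurableU.
have Z0 : ((mu \x mu) Z = 0)%E.
  apply: null_set_setU => //.
    by transitivity (mu H * mu setT)%E; [exact: product_measure1E|rewrite /mu H0 mul0e].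
  by transitivity (mu setT * mu H)%E; [exact: product_measure1E|rewrite /mu H0 mule0].
have mEZ : measurable (E `\` Z) by exact: measurableD.
apply: (@le_trans _ _ ((mu \x mu)%E (E `\` Z))).
  rewrite -[leRHS]adde0 -Z0; apply: le_trans (measureU2 _ mEZ mZ).
  apply: le_measure; rewrite ?inE//; first exact: measurableU.
  by move=> z Ez; have [Zz|nZz] := pselect (Z z); [right|left].
rewrite -borel_leb_prod// -leb_borel; last first.
  exact: measurable_preimage (@measurable_submx R N N) mEZ.
apply: le_mu_ext => z /= [[[Qx Qy] sq] nZ].
have nHx : ~ H (lsubmx z) by move=> Hx; apply: nZ; left.
have nHy : ~ H (rsubmx z) by move=> Hy; apply: nZ; right.
split; [exact: QO|exact: QO|apply: lt_le_trans sq _].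
rewrite /trunc_quot/= ler_wpM2r ?invr_ge0 ?powR_ge0//.
apply: ge0_ler_powR; rewrite ?nnegrE ?le_min ?ler01 ?normr_ge0 ?enorm_ge0//.
  exact: le_trans ler01 q1.
rewrite ge_min; apply/orP; right; rewrite !gu//; [|exact: QO|exact: QO].
by apply: le_trans (enorm_coor _ i); rewrite !mxE.
Qed.

Hypothesis hconn : connected Omega.
Hypothesis mu_u : measurable_fun (Omega : set (lebT R N)) (u : lebT R N -> 'rV[R]_m).
Hypothesis hlim : (s%:E * leb R (N + N) (quotient_set s))%E @[s --> +oo] --> 0%E.

Lemma coordinate_ae_constant (i : 'I_m) :
  exists c : R, {ae leb R N, forall x, Omega x -> u x ord0 i = c}.
Proof.
have mO : measurable Omega by exact: open_measurable_rV.
have mui : measurable_fun (Omega : set (lebT R N))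
    ((fun x => u x ord0 i) : lebT R N -> R).
  exact: (measurableT_comp (measurable_rV_coor i) mu_u).
have [H [g [mH H0 mg gu]]] := borel_representative mO mui.
have [c cP] : exists c, (borel_leb R N).-negligible (Omega `&` [set y | g y <> c]).
  apply: ae_constant_of_locally => // x Ox.
  have /nbhs_ballP[e /= e0 xeO] : nbhs x Omega by exact: open_nbhs_nbhs.
  have [|||||c cP] :=
      @ae_constant_of_negligible_neq R N q (ball x e) g q1 _ mg.
  - exact: measurable_ball_rV.
  - by move=> y z; exact: ball_mid.
  - by rewrite borel_leb_ball// ltry.
  - move=> eta eta0.
    have : nbhs 0%E [set t : \bar R | t < eta%:E]%E.
      by apply: open_nbhs_nbhs; split; [exact: open_ereal_lt_ereal|rewrite /= lte_fin].
    move=> /hlim[M [_ MP]]; exists (Num.max 1 (M + 1)).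
      by rewrite lt_max ltr01.
    move=> s; rewrite ge_max => /andP[s1 Ms].
    apply: (@le_trans _ _ _ _ _ _ (ltW (MP s _))).
      apply: lee_wpmul2l; first by rewrite lee_fin (le_trans ler01 s1).
      exact: superlevel_le (measurable_ball_rV x e0) mH H0 mg xeO gu.
    by apply: lt_le_trans Ms; rewrite ltrDl.
  - by rewrite borel_leb_ball// lte_fin exprn_gt0// mulrn_wgt0.
  by exists c; exists e.
exists c; move: cP => [A [mA A0 OA]]; exists (A `|` H); split.
- by apply: sub_caratheodory; apply: sub_sigma_algebra; exact: measurableU.
- rewrite leb_borel; last exact: measurableU.
  by apply: null_set_setU.
- move=> x /= /not_implyP[Ox ux].
  have [Hx|nHx] := pselect (H x); [by right|left].
  by apply: OA; split => //=; rewrite gu.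
Qed.

End coordinate.

Theorem corollary1p1 (R : realType) (N m : nat) (hN : (1 <= N)%N)
    (hm : (1 <= m)%N) (Omega : set 'rV[R]_N) (hopen : open Omega)
    (hconn : connected Omega)
    (q : R) (hq : 1 <= q) (u : 'rV[R]_N -> 'rV[R]_m) (hu : Lq Omega q u)
    (hlim :
      (s%:E * leb R (N + N) [set z : 'rV[R]_(N + N) |
         let x := lsubmx z in let y := rsubmx z in
         [/\ Omega x, Omega y &
           (s < enorm (u y - u x) `^ q / enorm (y - x) `^ (q + N%:R))%R]])%E
        @[s --> +oo] --> 0%E) :
  exists c : 'rV[R]_m, {ae leb R N, forall x, Omega x -> u x = c}.
Proof.
have /choice[c cP] := coordinate_ae_constant hopen hq hconn hu.1 hlim.
pose aeF := ae_filter_ringOfSetsType (leb R N); exists (\row_i c i).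
apply: (@filterS _ _ aeF _ _ _ (filter_forall aeF cP)) => x ux Ox.
by apply/rowP => i; rewrite mxE; exact: ux.
Qed.
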